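(* Let $M\ge2$ be even, let $\boldsymbol u,\boldsymbol\alpha\in\mathbb R^{2\times M}$ with $\|\boldsymbol u\|_F=\|\boldsymbol\alpha\|_F=1$, and let $\theta\in[0,2\pi]$. If $\hat\delta\in[0,1]$ is a solution of $$\min_{\delta\in[0,1]}\left\|\mathbf O_\theta\boldsymbol u\,\boldsymbol\beta(-\delta)-\boldsymbol\alpha\right\|_F^2,$$ then $\hat\delta$ satisfies $$\sum_{k\in\{1,3,\dots,M-1\}}w_k^{1,\theta}\sin\big((k+1)\pi\hat\delta\big)=\sum_{k\in\{1,3,\dots,M-1\}}w_k^{2,\theta}\cos\big((k+1)\pi\hat\delta\big),$$ where, for $k\in\{1,3,\dots,M-1\}$, $$w_k^{1,\theta}=(k+1)\,\mathrm{Tr}(\boldsymbol\Sigma_{k,\theta}),\qquad w_k^{2,\theta}=-(k+1)\,\mathrm{Tr}(\boldsymbol\Sigma_{k,\theta}\mathbf O_{\pi/2}),$$ and $\boldsymbol\Sigma_{k,\theta}\in\mathbb R^{2\times2}$ is the diagonal block of the matrix $\boldsymbol\alpha^\top\mathbf O_\theta\boldsymbol u\in\mathbb R^{M\times M}$ formed by rows $k,k+1$ and columns $k,k+1$.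
   Context: $\|\cdot\|_F$ is the Frobenius norm. For $\theta\in\mathbb R$, $\mathbf O_\theta=\begin{pmatrix}\cos\theta&-\sin\theta\\ \sin\theta&\cos\theta\end{pmatrix}$. For $s\in\mathbb R$, $\boldsymbol\beta(s)\in\mathbb R^{M\times M}$ is the block-diagonal matrix with successive $2\times2$ diagonal blocks $\mathbf O_{2\pi s},\mathbf O_{4\pi s},\dots,\mathbf O_{M\pi s}$ and zeros elsewhere. *)

(* Defs.v *)
From mathcomp Require Import all_boot all_order all_algebra.
From mathcomp Require Import all_classical all_reals all_analysis.
Set Implicit Arguments.
Unset Strict Implicit.
Unset Printing Implicit Defensive.
Import Order.TTheory GRing.Theory Num.Theory.
Local Open Scope ring_scope.

Definition frobnorm (R : realType) (m n : nat) (A : 'M[R]_(m, n)) : R :=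
  Num.sqrt (\sum_(i < m) \sum_(j < n) A i j ^+ 2).

Definition rotmx (R : realType) (theta : R) : 'M[R]_2 :=
  \matrix_(i, j)
    if i == j then cos theta
    else if i == ord0 then - sin theta else sin theta.

(* Indices are 0-based: i and j lie in the same 2 x 2 diagonal block iff
   i./2 = j./2; the block number b = i./2 is the rotation by 2 (b + 1) pi s,
   and the position of i inside its block is the parity of i. *)
Definition betamx (R : realType) (M : nat) (s : R) : 'M[R]_M :=
  \matrix_(i, j)
    if i./2 == j./2
    then rotmx ((i./2).+1.*2%:R * pi * s) (inord (odd i)) (inord (odd j))
    else 0.

(* With rows and columns numbered from 1 to M, the diagonal 2 x 2 block with
   rows and columns k, k+1; the corresponding 0-based indices are k-1 and k.
   Only meaningful for 0 < k: then k.-1 + i < M, so that the default value of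
   insubd is never used. *)
Definition diag_block (R : realType) (M : nat) (A : 'M[R]_M) (k : 'I_M) :
    'M[R]_2 :=
  let f (i : 'I_2) : 'I_M := insubd k (k.-1 + i)%N in mxsub f f A.

Definition Sigma (R : realType) (M : nat) (u alpha : 'M[R]_(2, M)) (theta : R)
    (k : 'I_M) : 'M[R]_2 :=
  diag_block (alpha^T *m rotmx theta *m u) k.

Definition w1 (R : realType) (M : nat) (u alpha : 'M[R]_(2, M)) (theta : R)
    (k : 'I_M) : R :=
  k.+1%:R * \tr (Sigma u alpha theta k).

Definition w2 (R : realType) (M : nat) (u alpha : 'M[R]_(2, M)) (theta : R)
    (k : 'I_M) : R :=
  - k.+1%:R * \tr (Sigma u alpha theta k *m rotmx (pi / 2)).

Definition objective (R : realType) (M : nat) (u alpha : 'M[R]_(2, M))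
    (theta delta : R) : R :=
  frobnorm (rotmx theta *m u *m betamx M (- delta) - alpha) ^+ 2.

(* Main.v *)
(* Since beta(-delta) rotates the k-th pair of columns by -(k+1) pi delta, the
   objective equals a constant minus
     2 sum_k (Tr Sigma_k cos ((k+1) pi delta)
              - Tr (Sigma_k O_(pi/2)) sin ((k+1) pi delta)).
   As k is odd, this is 1-periodic in delta, so a minimizer over [0, 1], even at
   an endpoint, is an interior minimizer over [-1, 2]; the derivative vanishes
   there, which is the claim up to the factor 2 pi. *)
Require Import Defs.
From mathcomp Require Import all_boot all_order all_algebra.
From mathcomp Require Import all_classical all_reals all_analysis.
From mathcomp Require Import zify ring lra.
Import Order.TTheory GRing.Theory Num.Theory.
Local Open Scope ring_scope.

(** For odd [k] this is the left column of the block whose right column is [k]. The default of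
    [insubd] is harmless: [k.-1] is always below [M]. *)
Definition ord_prev {M : nat} (k : 'I_M) : 'I_M := insubd k k.-1.

Lemma val_ord_prev {M} (k : 'I_M) : ord_prev k = k.-1 :> nat.
Proof. by rewrite val_insubd (leq_ltn_trans (leq_pred k)). Qed.

(** Indices are grouped by the odd member [p i] of their pair; evenness of [M] keeps that member
    below [M]. *)
Lemma sum_ord_pairs {V : nmodType} {M} (F : 'I_M -> V) : ~~ odd M ->
  \sum_i F i = \sum_(k < M | odd k) (F (ord_prev k) + F k).
Proof.
move=> evenM; pose p (i : 'I_M) : 'I_M := insubd i i./2.*2.+1.
have pE i : p i = i./2.*2.+1 :> nat.
  by rewrite val_insubd ifT //; have := ltn_ord i; lia.
clearbody p.
rewrite (partition_big p (fun k => odd k)) => [|i _]; last by rewrite pE; lia.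
apply: eq_bigr => k odd_k; have vp := val_ord_prev k.
rewrite (bigD1 (ord_prev k)) /=; last by apply/eqP/ord_inj; rewrite pE vp; lia.
congr (_ + _); rewrite (bigD1 k) /=; last first.
  rewrite -!val_eqE /= pE vp; lia.
rewrite big1 ?addr0 // => i; rewrite -!val_eqE /= pE vp; lia.
Qed.

(** Rows outside the block of a column hold zeros there, so only two terms survive and each row of
    [A] is rotated pair by pair. *)
Lemma mul_betamx_pair {R : realType} {m M} (A : 'M[R]_(m, M)) s i (k : 'I_M) :
    ~~ odd M -> odd k ->
  let phi := k.+1%:R * pi * s in
  (A *m betamx M s) i (ord_prev k) =
    A i (ord_prev k) * cos phi + A i k * sin phi /\
  (A *m betamx M s) i k =
    - A i (ord_prev k) * sin phi + A i k * cos phi.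
Proof.
move=> evenM odd_k phi; have vp := val_ord_prev k.
(* Block number [k./2], counted from 0, has the angle [(k./2).+1.*2%:R * pi * s], which is [phi]
   because [k] is odd. *)
have kk : (k./2).+1.*2 = k.+1 by lia.
have pk : (k.-1)./2 = k./2 by lia.
have op : odd k.-1 = false by lia.
have i0 : inord 0 = ord0 :> 'I_2 by apply/val_inj; rewrite /= inordK.
have i1 : inord 1 = ord_max :> 'I_2 by apply/val_inj; rewrite /= inordK.
have entry (j : 'I_M) : j./2 = k./2 ->
    (A *m betamx M s) i j =
      A i (ord_prev k) * betamx M s (ord_prev k) j + A i k * betamx M s k j.
  move=> jk; rewrite mxE (sum_ord_pairs _ evenM) (bigD1 k) //=.
  rewrite [X in _ + X]big1 ?addr0 // => l /andP[odd_l].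
  rewrite -val_eqE /= => lk; have vl := val_ord_prev l.
  rewrite [betamx M s _ j]mxE [betamx M s l j]mxE !ifF ?mulr0 ?addr0 //; lia.
rewrite !entry ?vp ?pk // ![betamx _ _ _ _]mxE ?vp pk eqxx kk odd_k op.
rewrite i0 i1 -!/phi ![rotmx _ _ _]mxE.
by rewrite /=; split; ring.
Qed.

(** Rows and columns k, k+1 counted from 1 are [ord_prev k] and [k] counted from 0. *)
Lemma SigmaE {R : realType} {M} (u alpha : 'M[R]_(2, M)) theta (k : 'I_M) :
    odd k -> let W := rotmx theta *m u in
    let f (i : 'I_2) := if i == ord0 then ord_prev k else k in
  Sigma u alpha theta k =
    \matrix_(i, j) \sum_l alpha l (f i) * W l (f j).
Proof.
move=> odd_k W f.
have fE (i : 'I_2) : insubd k (k.-1 + i)%N = f i.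
  apply: ord_inj; rewrite val_insubd /f; have := ltn_ord k.
  by case: i => -[|[|//]] ? /=; rewrite ?val_ord_prev; case: ifP; lia.
rewrite /Sigma -mulmxA -/W; apply/matrixP => i j; clearbody W.
rewrite !mxE !fE.
by apply: eq_bigr => l _; rewrite mxE.
Qed.

Lemma tr_Sigma {R : realType} {M} (u alpha : 'M[R]_(2, M)) theta (k : 'I_M) :
    odd k -> let W := rotmx theta *m u in
  \tr (Sigma u alpha theta k) =
    \sum_i (alpha i (ord_prev k) * W i (ord_prev k) + alpha i k * W i k).
Proof.
move=> odd_k W; rewrite SigmaE // -/W /mxtrace; clearbody W.
rewrite big_ord_recl big_ord1 !mxE /=.
by rewrite -big_split.
Qed.

(** The quarter turn has zero diagonal and off-diagonal entries -1 and 1, so the trace picks out the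
    antisymmetric part of the block. *)
Lemma tr_Sigma_rot {R : realType} {M} (u alpha : 'M[R]_(2, M)) theta
    (k : 'I_M) : odd k -> let W := rotmx theta *m u in
  \tr (Sigma u alpha theta k *m rotmx (pi / 2)) =
    \sum_i (alpha i (ord_prev k) * W i k - alpha i k * W i (ord_prev k)).
Proof.
move=> odd_k W; rewrite SigmaE // -/W /mxtrace; clearbody W.
rewrite big_ord_recl big_ord1 !mxE.
rewrite !big_ord_recl !big_ord0 !mxE /= cos_pihalf sin_pihalf.
by rewrite !big_ord_recl !big_ord0; ring.
Qed.

Lemma frobnorm_sqr {R : realType} {m n} (A : 'M[R]_(m, n)) :
  frobnorm A ^+ 2 = \sum_i \sum_j A i j ^+ 2.
Proof.
rewrite sqr_sqrtr // sumr_ge0 // => i _; rewrite sumr_ge0 // => j _.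
exact: sqr_ge0.
Qed.

Lemma objectiveE {R : realType} {M} (u alpha : 'M[R]_(2, M)) theta delta :
    ~~ odd M ->
  objective u alpha theta delta =
    frobnorm (rotmx theta *m u) ^+ 2 + frobnorm alpha ^+ 2
    - 2 * \sum_(k < M | odd k)
        (\tr (Sigma u alpha theta k) * cos (k.+1%:R * pi * delta)
         - \tr (Sigma u alpha theta k *m rotmx (pi / 2))
           * sin (k.+1%:R * pi * delta)).
Proof.
move=> evenM; rewrite /objective !frobnorm_sqr; set W := rotmx theta *m u.
under [X in X = _]eq_bigr do rewrite (sum_ord_pairs _ evenM).
under [X in _ = X + _ - _]eq_bigr do rewrite (sum_ord_pairs _ evenM).
under [X in _ = _ + X - _]eq_bigr do rewrite (sum_ord_pairs _ evenM).
(* With the sum over pairs outermost everywhere, the identity is checked for each pair and each row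
   separately. *)
rewrite ![\sum_(i < 2) _]exchange_big /= -big_split mulr_sumr -sumrB /=.
apply: eq_bigr => k odd_k; rewrite tr_Sigma // tr_Sigma_rot // -/W.
rewrite 2!mulr_suml -sumrB mulr_sumr -big_split -sumrB /=.
apply: eq_bigr => i _.
have [] := mul_betamx_pair W (- delta) i k evenM odd_k.
rewrite mulrN cosN sinN.
rewrite ![fun_of_matrix (_ - _) _ _]mxE ![fun_of_matrix (- _) _ _]mxE => -> ->.
have := cos2Dsin2 (k.+1%:R * pi * delta).
set c := cos _; set s := sin _ => cs1.
(* A rotation preserves the squared length of the pair: the factor 1 is replaced by
   [c ^+ 2 + s ^+ 2], after which the identity is polynomial. *)
rewrite -[W i (ord_prev k) ^+ 2 + _]mulr1 -[in X in _ = X - _]cs1; ring.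
Qed.

Lemma is_derive_trig {R : realType} {n : nat} (a b c : 'I_n -> R)
    (P : pred 'I_n) (x : R) :
  is_derive x 1
    (fun d => \sum_(k < n | P k) (a k * cos (c k * d) - b k * sin (c k * d)))
    (- \sum_(k < n | P k) c k * (a k * sin (c k * x) + b k * cos (c k * x))).
Proof.
(* The filter moves into the summand, so that the sum runs over all indices as [is_derive_sum]
   requires. *)
pose h k d := if P k then a k * cos (c k * d) - b k * sin (c k * d) else 0.
rewrite [X in is_derive _ _ X _](_ : _ = \sum_k h k); last first.
  by apply/funext => d; rewrite fct_sumE big_mkcond.
rewrite -sumrN [X in is_derive _ _ _ X]big_mkcond.
apply: is_derive_sum => k; rewrite /h.
case: (P k); last exact: is_derive_cst.
have cx : is_derive x 1 (fun d => c k * d) (c k).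
  by have := is_deriveZ (c k) (is_derive_id x 1); rewrite /GRing.scale /= mulr1.
have dcos := is_deriveZ (a k) (is_derive1_comp (is_derive_cos (c k * x)) cx).
have dsin := is_deriveZ (b k) (is_derive1_comp (is_derive_sin (c k * x)) cx).
by apply: (is_derive_eq (is_deriveB dcos dsin)); rewrite /GRing.scale /=; ring.
Qed.

(** For odd [k] the shift adds [k.+1./2] full turns to each angle. *)
Lemma objectiveD1 {R : realType} {M} (u alpha : 'M[R]_(2, M)) theta delta :
    ~~ odd M ->
  objective u alpha theta (delta + 1) = objective u alpha theta delta.
Proof.
move=> evenM; rewrite !objectiveE //; congr (_ - 2 * _).
apply: eq_bigr => k odd_k.
have -> : k.+1%:R * pi * (delta + 1) =
    k.+1%:R * pi * delta + pi *+ 2 *+ k.+1./2 :> R.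
  rewrite mulrDr mulr1 -mulrnA; congr (_ + _).
  by rewrite mulr_natl; congr (_ *+ _); lia.
by rewrite (periodicn (@cosD2pi R)) (periodicn (@sinD2pi R)).
Qed.

(* For M even, the odd k : 'I_M are exactly 1, 3, ..., M - 1. *)
Theorem proposition2p4 (R : realType) (M : nat) (hM2 : (2 <= M)%N)
    (hMeven : ~~ odd M) (u alpha : 'M[R]_(2, M))
    (hu : frobnorm u = 1) (halpha : frobnorm alpha = 1)
    (theta : R) (htheta : 0 <= theta <= 2 * pi)
    (hdelta : R) (hdelta01 : 0 <= hdelta <= 1)
    (hmin : forall delta : R, 0 <= delta <= 1 ->
       objective u alpha theta hdelta <= objective u alpha theta delta) :
  \sum_(k < M | odd k) w1 u alpha theta k * sin (k.+1%:R * pi * hdelta) =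
  \sum_(k < M | odd k) w2 u alpha theta k * cos (k.+1%:R * pi * hdelta).
Proof.
pose a k := \tr (Sigma u alpha theta k).
pose b k := \tr (Sigma u alpha theta k *m rotmx (pi / 2)).
pose c (k : 'I_M) : R := k.+1%:R * pi.
set f := objective u alpha theta in hmin.
have df (x : R) : is_derive x 1 f
    (2 * \sum_(k < M | odd k)
       c k * (a k * sin (c k * x) + b k * cos (c k * x))).
  pose K := frobnorm (rotmx theta *m u) ^+ 2 + frobnorm alpha ^+ 2.
  have -> : f = cst K - 2 \*: (fun d => \sum_(k < M | odd k)
      (a k * cos (c k * d) - b k * sin (c k * d))).
    by apply/funext => d; rewrite /f objectiveE.
  have dtrig := is_derive_trig a b c (fun k => odd k) x.
  apply: (is_derive_eq (is_deriveB (is_derive_cst K x 1) (is_deriveZ 2 dtrig))).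
  by rewrite /GRing.scale /= sub0r mulrN opprK.
(* A shift by 1 upwards for [t < 0], or downwards for [t > 1], brings [t] back into [0, 1]. *)
have fmin t : t \in `]-1, 2[ -> f hdelta <= f t.
  rewrite in_itv /= => /andP[t_gtN1 t_lt2].
  case: (ltP t 0) => [t_lt0|t_ge0].
    by rewrite -[f t]objectiveD1 //; apply: hmin; lra.
  case: (leP t 1) => [t_le1|t_gt1]; first by apply: hmin; lra.
  by rewrite -(subrK 1 t) /f objectiveD1 //; apply: hmin; lra.
have f'0 : is_derive hdelta 1 f 0.
  apply: (@derive1_at_min _ f (-1) 2) => //; first lra.
  by rewrite in_itv /=; lra.
(* The two values of the derivative at [hdelta] are equated. *)
have [_] := f'0; have [_ ->] := df hdelta => eq0.
have pi0 : 2 * pi != 0 :> R by rewrite mulf_neq0 ?pnatr_eq0 ?gt_eqF ?pi_gt0.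
apply/eqP; rewrite -subr_eq0 -sumrB; apply/eqP.
(* The factor 2 matches the one in the derivative, and [pi] is absorbed into [c k]; the minus sign
   in [w2] turns the difference into the sum found there. *)
apply: (mulfI pi0); rewrite mulr0 -[RHS]eq0 -[LHS]mulrA; congr (2 * _).
rewrite mulr_sumr; apply: eq_bigr => k _.
by rewrite /w1 /w2 -/(a k) -/(b k) /c; ring.
Qed.
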